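(* Let $c=(c_1,\ldots,c_r)$ be a profile and let $D_c(q)=\sum_{n\ge0}\mathcal{D}_c(n)q^n$, where $\mathcal{D}_c(n)$ is the number of cylindric partitions of size $n$ with profile $c$ into distinct parts. Then there exist a polynomial $rg_c(q)$ depending on $c$, an integer $k\in\mathbb{N}$, nonnegative integers $B_0,\ldots,B_k$, and complex numbers $\alpha_i^t,\beta_i^t$ ($0\le t\le k$, $1\le i\le B_t$) such that \[ D_c(q)=rg_c(q)+\sum_{i=1}^{B_0}\alpha_i^0\,(-\beta_i^0q;q)_\infty+\sum_{t=1}^{k}\sum_{i=1}^{B_t}\alpha_i^t\left[\left(z\frac{\mathrm{d}}{\mathrm{d}z}\right)^t(-\beta_i^t zq;q)_\infty\right]_{z=1}. \]
   Context: A profile is a composition $c=(c_1,\ldots,c_r)$ of nonnegative integers with $\ell=c_1+\cdots+c_r>0$. A cylindric partition with profile $c$ is a tuple $\Lambda=(\lambda^{(1)},\ldots,\lambda^{(r)})$ of integer partitions such that for all $j\ge1$: $\lambda^{(i)}_j\ge\lambda^{(i+1)}_{j+c_{i+1}}$ for $1\le i\le r-1$, and $\lambda^{(r)}_j\ge\lambda^{(1)}_{j+c_1}$ (missing parts are taken to be $0$). Its size $|\Lambda|$ is the sum of all parts of all $\lambda^{(i)}$. It is into distinct parts if all the (nonzero) parts occurring in $\lambda^{(1)},\ldots,\lambda^{(r)}$ together are pairwise distinct (no value occurs twice, whether in the same or in different components). $(a;q)_\infty=\prod_{j\ge1}(1-aq^{j-1})$, $|q|<1$. *)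

(* Defs.v *)
From HB Require Import structures.
From mathcomp Require Import all_boot all_order all_algebra finmap.
From mathcomp Require Import all_classical all_reals all_analysis.
From mathcomp Require Import complex.

Set Implicit Arguments.
Unset Strict Implicit.
Unset Printing Implicit Defensive.

Import Order.TTheory GRing.Theory Num.Theory.
Import numFieldNormedType.Exports.

Local Open Scope classical_set_scope.
Local Open Scope complex_scope.
Local Open Scope ring_scope.

(* MathComp-Analysis puts the topology of the modulus on K^o for every
   numFieldType K; transfer it to the complex numbers R[i] themselves. *)
HB.instance Definition _ (R : rcfType) := NormedModule.copy R[i] R[i]^o.

(* Parts are listed without trailing zeros; a missing part is read as 0 through
   [nth 0]. *)
Definition is_partition (s : seq nat) : bool :=
  sorted geq s && (0%N \notin s).

Definition is_profile (r : nat) (c : r.-tuple nat) : Prop :=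
  (0 < \sum_(i < r) tnth c i)%N.

(* Components and parts are numbered from 0; [ordS] is the cyclic successor on
   'I_r, so i = r - 1 gives the inequality between the last and first
   components. *)
Definition is_cylindric (r : nat) (c : r.-tuple nat)
    (L : r.-tuple (seq nat)) : Prop :=
  (forall i : 'I_r, is_partition (tnth L i)) /\
  (forall (i : 'I_r) (j : nat),
     (nth 0 (tnth L (ordS i)) (j + tnth c (ordS i)) <= nth 0 (tnth L i) j)%N).

Definition cyl_size (r : nat) (L : r.-tuple (seq nat)) : nat :=
  (\sum_(i < r) sumn (tnth L i))%N.

Definition distinct_parts (r : nat) (L : r.-tuple (seq nat)) : bool :=
  uniq (flatten L).

Definition cyl_distinct (r : nat) (c : r.-tuple nat) (n : nat) :
    set (r.-tuple (seq nat)) :=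
  [set L | [/\ is_cylindric c L, distinct_parts L & cyl_size L = n]].

(* [fset_set] is the empty set on infinite sets; see [cyl_distinct_finite]. *)
Definition cyl_distinct_count (r : nat) (c : r.-tuple nat) (n : nat) : nat :=
  #|` fset_set (cyl_distinct c n)|.

Lemma cyl_distinct_finite (r : nat) (c : r.-tuple nat) (n : nat) :
  finite_set (cyl_distinct c n).
Proof.
pose f (t : r.-tuple (n.-bseq 'I_n.+1)) : r.-tuple (seq nat) :=
  [tuple map val (tnth t i : seq 'I_n.+1) | i < r].
apply: (@sub_finite_set _ _ (f @` setT)); last exact/finite_image/finite_finset.
move=> L [[Lp _] _ sL] /=.
have hsum i : (sumn (tnth L i) <= n)%N.
  by rewrite -sL /cyl_size (bigD1 i) //= leq_addr.
have hsize i : (size (tnth L i) <= n)%N.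
  apply: leq_trans (hsum i).
  have /andP[_] := Lp i; elim: (tnth L i) => //= x s IH.
  rewrite inE negb_or eq_sym -lt0n => /andP[x0 /IH].
  by rewrite -add1n; exact: leq_add.
have hmem i x : x \in tnth L i -> (x < n.+1)%N.
  rewrite ltnS => xs; apply: leq_trans (hsum i).
  elim: (tnth L i) xs => //= y s IH; rewrite inE => /predU1P[->|/IH le_xs].
    exact: leq_addr.
  exact: leq_trans le_xs (leq_addl _ _).
have hs i : (size (map (@inord n) (tnth L i)) <= n)%N by rewrite size_map.
exists [tuple Bseq (hs i) | i < r] => //.
apply: eq_from_tnth => i; rewrite !tnth_mktuple /= -map_comp.
by rewrite -[RHS]map_id; apply/eq_in_map => x /hmem xn /=; rewrite inordK.
Qed.

Definition qPochhammer (R : realType) (a q : R[i]) : R[i] :=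
  limn (fun n : nat => \prod_(j < n) (1 - a * q ^+ j)).

(* The operator z d/dz, with the complex derivative. *)
Definition euler_op (R : realType) (f : R[i] -> R[i]) : R[i] -> R[i] :=
  fun z => z * derive1 f z.

(* Main.v *)
Require Import Defs.
From HB Require Import structures.
From mathcomp Require Import all_boot all_order all_algebra finmap.
From mathcomp Require Import all_classical all_reals all_analysis.
From mathcomp Require Import complex zify ring lra.

(* The largest part M of a cylindric partition into distinct parts is the first
   part of a unique component i, and c_i > 0.  Deleting it leaves an arbitrary
   cylindric partition into distinct parts < M whose profile is c with one unit
   moved from place i to place i + 1.  Hence the vector P_M(q), indexed by the
   profiles of level l, of the generating functions with all parts <= M
   satisfies P_M = (1 + q^M A) P_(M-1), where A counts these moves.

   The matrix A is normal: for i <> j, moving a unit out of i in x and out of j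
   in y gives the same profile iff the moves j for x and i for y can be undone
   and give the same profile, both conditions being one balance equation between
   x and y.  So A is unitarily diagonalizable, and P_M is a combination, with
   coefficients independent of q and M, of the products
   \prod_(1 <= j <= M) (1 + beta q^j), beta an eigenvalue of A.  Letting M tend
   to infinity gives the formula with no polynomial part and no derivatives. *)

Set Implicit Arguments.
Unset Strict Implicit.
Unset Printing Implicit Defensive.

Import Order.TTheory GRing.Theory Num.Theory.
Import numFieldNormedType.Exports.
Import ComplexField.Normc.

Local Open Scope classical_set_scope.
Local Open Scope complex_scope.
Local Open Scope ring_scope.

(** * Removing the largest part *)

(* The profile left by deleting the largest part from component i; meaningful
   only if [0 < tnth c i], because of the truncated subtraction. *)
Definition hop (r : nat) (c : r.-tuple nat) (i : 'I_r) : r.-tuple nat :=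
  [tuple (tnth c k - (k == i) + (k == ordS i))%N | k < r].

Definition push (r : nat) (M : nat) (i : 'I_r) (L : r.-tuple (seq nat)) :
    r.-tuple (seq nat) :=
  [tuple if k == i then M :: tnth L k else tnth L k | k < r].

(** The recursion is on a bound for the parts: the first block lacks the part [M'.+1], block [i] has
    it at the head of component [i]. *)
Fixpoint enum_distinct (r M : nat) (c : r.-tuple nat) :
    seq (r.-tuple (seq nat)) :=
  if M is M'.+1 then
    enum_distinct M' c ++
    flatten [seq [seq push M i L | L <- enum_distinct M' (hop c i)]
            | i <- enum 'I_r & (0 < tnth c i)%N]
  else [:: [tuple [::] | _ < r]].

Lemma hopE (r : nat) (c : r.-tuple nat) (i k : 'I_r) : (0 < tnth c i)%N ->
  (tnth (hop c i) k + (k == i) = tnth c k + (k == ordS i))%N.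
Proof.
move=> ci; rewrite tnth_mktuple addnAC subnK //.
by case: eqVneq => // ->.
Qed.

Lemma sum_eq_ord (r : nat) (i : 'I_r) : (\sum_(k < r) (k == i))%N = 1%N.
Proof. by rewrite (bigD1 i) //= eqxx big1 // => k /negPf ->. Qed.

Lemma sum_hop (r : nat) (c : r.-tuple nat) (i : 'I_r) : (0 < tnth c i)%N ->
  (\sum_(k < r) tnth (hop c i) k = \sum_(k < r) tnth c k)%N.
Proof.
move=> ci; apply: (@addIn 1%N).
rewrite -{1}(sum_eq_ord i) -(sum_eq_ord (ordS i)) -!big_split /=.
by apply: eq_bigr => k _; exact: hopE.
Qed.

(** The boolean [k == i] shifts the index in the lengthened component only, so one formula serves
    all components. *)
Lemma nth_push (r M : nat) (i k : 'I_r) (L : r.-tuple (seq nat)) (j : nat) :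
  nth 0%N (tnth (push M i L) k) (j + (k == i)) = nth 0%N (tnth L k) j.
Proof. by rewrite tnth_mktuple; case: eqP; rewrite ?addn1 ?addn0. Qed.

Lemma is_partition_cons (M : nat) (s : seq nat) :
  is_partition (M :: s) = [&& all (geq M) s, (0 < M)%N & is_partition s].
Proof.
rewrite /is_partition /= (path_sortedE (rev_trans leq_trans)).
rewrite inE negb_or eq_sym -lt0n.
by case: (all _ s); case: (sorted _ s); case: (0 < M)%N.
Qed.

Lemma nth_le_all (M : nat) (s : seq nat) j : {in s, forall x, x <= M}%N ->
  (nth 0 s j <= M)%N.
Proof.
move=> sM; case: (ltnP j (size s)) => js; last by rewrite nth_default.
by apply/sM/mem_nth.
Qed.

Lemma mem_push (r M : nat) (i k : 'I_r) (L : r.-tuple (seq nat)) x :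
  (x \in tnth (push M i L) k) = ((k == i) && (x == M)) || (x \in tnth L k).
Proof. by rewrite tnth_mktuple; case: eqP; rewrite ?inE. Qed.

(** Prepending shifts the indices of component [i] by one, and [hop] absorbs the shift into the
    profile: the inequality at [j] for [hop c i] is the one at [j + (k == i)] for [c]. *)
Lemma cylindric_push (r : nat) (c : r.-tuple nat) (M : nat) (i : 'I_r)
    (L : r.-tuple (seq nat)) :
  (0 < tnth c i)%N -> (forall k x, x \in tnth L k -> x <= M)%N ->
  is_cylindric c (push M.+1 i L) <-> is_cylindric (hop c i) L.
Proof.
move=> ci LM; rewrite /is_cylindric.
have shift k j :
    (nth 0 (tnth (push M.+1 i L) (ordS k)) (j + (k == i) + tnth c (ordS k)) <=
      nth 0 (tnth (push M.+1 i L) k) (j + (k == i)))%N =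
    (nth 0 (tnth L (ordS k)) (j + tnth (hop c i) (ordS k)) <=
      nth 0 (tnth L k) j)%N.
  rewrite nth_push; congr (_ <= _)%N.
  rewrite -[RHS](nth_push M.+1 i (ordS k)); congr nth.
  by have := hopE (ordS k) ci; rewrite (inj_eq (@ordS_inj _)); lia.
split=> -[Lp LH]; split.
- move=> k; have := Lp k; rewrite tnth_mktuple; case: ifP => // _.
  by rewrite is_partition_cons => /and3P[].
- by move=> k j; rewrite -shift.
- move=> k; rewrite tnth_mktuple; case: ifP => // _.
  rewrite is_partition_cons Lp /= andbT.
  by apply/allP => x /LM /leqW.
(* The only inequality not of the shifted form has [k = i] and [j = 0]; its larger side is the new
   part [M.+1]. *)
- move=> k j; have [jk|jk] := leqP (k == i) j.
    by rewrite -(subnK jk) shift.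
  have -> : j = 0%N by case: (k == i) jk; case: j.
  have -> : k = i by apply/eqP; case: (k == i) jk.
  have -> : nth 0%N (tnth (push M.+1 i L) i) 0 = M.+1.
    by rewrite tnth_mktuple eqxx.
  apply: nth_le_all => x; rewrite mem_push => /orP[/andP[_ /eqP ->]|/LM] //.
  exact: leqW.
Qed.

Lemma count_flatten_tuple (r : nat) (L : r.-tuple (seq nat)) (a : pred nat) :
  count a (flatten L) = (\sum_(k < r) count a (tnth L k))%N.
Proof. by rewrite count_flatten sumnE big_map big_tuple. Qed.

Lemma mem_flatten_tuple (r : nat) (L : r.-tuple (seq nat)) x :
  reflect (exists k, x \in tnth L k) (x \in flatten L).
Proof.
apply: (iffP flattenP) => [[s /tnthP[k ->] xs]|[k xs]]; first by exists k.
by exists (tnth L k); rewrite ?mem_tnth.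
Qed.

Lemma perm_flatten_push (r M : nat) (i : 'I_r) (L : r.-tuple (seq nat)) :
  perm_eq (flatten (push M i L)) (M :: flatten L).
Proof.
apply/permP => a; rewrite count_flatten_tuple [RHS]/= count_flatten_tuple.
rewrite [in LHS](bigD1 i) // [in RHS](bigD1 i) // tnth_mktuple eqxx /= -addnA.
congr (_ + (_ + _))%N; apply: eq_bigr => k /negPf ki.
by rewrite tnth_mktuple ki.
Qed.

Lemma cyl_sizeE (r : nat) (L : r.-tuple (seq nat)) :
  cyl_size L = sumn (flatten L).
Proof. by rewrite sumn_flatten sumnE big_map big_tuple. Qed.

Lemma cyl_size_push (r M : nat) (i : 'I_r) (L : r.-tuple (seq nat)) :
  cyl_size (push M i L) = (M + cyl_size L)%N.
Proof. by rewrite !cyl_sizeE (perm_sumn (perm_flatten_push M i L)). Qed.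

Lemma distinct_parts_push (r M : nat) (i : 'I_r) (L : r.-tuple (seq nat)) :
  distinct_parts (push M i L) = (M \notin flatten L) && distinct_parts L.
Proof. by rewrite /distinct_parts (perm_uniq (perm_flatten_push M i L)). Qed.

Lemma distinct_parts_inj (r : nat) (L : r.-tuple (seq nat)) x (i k : 'I_r) :
  distinct_parts L -> x \in tnth L i -> x \in tnth L k -> i = k.
Proof.
move=> /count_uniq_mem Lu xi xk; apply/eqP/negPn/negP => ik.
have := leq_b1 (x \in flatten L); rewrite -Lu count_flatten_tuple.
rewrite (bigD1 i) //= (bigD1 k) 1?eq_sym //=.
move: xi xk; rewrite -!has_pred1 !has_count => xi xk; apply/negP.
by rewrite -ltnNge addnA; apply: leq_trans (leq_addr _ _); exact: leq_add xi xk.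
Qed.

Lemma ordS_fixed (r : nat) (i : 'I_r) : ordS i = i -> r = 1%N.
Proof.
move=> /(congr1 val) /= Si; have [ir|ri] := ltnP i.+1 r.
  by move: Si; rewrite modn_small //; lia.
have ri' : r = i.+1 by apply/eqP; rewrite eqn_leq ri ltn_ord.
by move: Si; rewrite -ri' modnn => i0; rewrite ri' -i0.
Qed.

Lemma sum_cyclic_fixed (r : nat) (c : r.-tuple nat) (i : 'I_r) :
  ordS i = i -> (\sum_(k < r) tnth c k = tnth c i)%N.
Proof.
move=> /ordS_fixed r1; move: c i; rewrite r1 => c i.
by rewrite big_ord_recl big_ord0 addn0 (ord1 i).
Qed.

(* If [c_i = 0], the preceding component would have to contain the largest part
   as well. *)
Lemma largest_part_pos (r : nat) (c : r.-tuple nat) (L : r.-tuple (seq nat))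
    (M : nat) (i : 'I_r) :
  is_profile c -> is_cylindric c L -> distinct_parts L ->
  (forall k x, x \in tnth L k -> x <= M.+1)%N ->
  nth 0%N (tnth L i) 0 = M.+1 -> (0 < tnth c i)%N.
Proof.
move=> cP [_ LH] Ld LM Li; rewrite lt0n; apply/eqP => ci.
have {LH} := LH (ord_pred i) 0%N; rewrite ord_predK ci Li => Mle.
have mem k : (M.+1 <= nth 0 (tnth L k) 0)%N -> M.+1 \in tnth L k.
  move: (LM k); case: (tnth L k) => //= x s /(_ x (mem_head _ _)) xM Mx.
  by rewrite inE eqn_leq Mx xM.
have Mi : M.+1 \in tnth L i by apply: mem; rewrite Li.
have ip := distinct_parts_inj Ld Mi (mem _ Mle).
(* Distinctness makes [i] its own predecessor, so r = 1 and the whole sum is [tnth c i = 0]. *)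
move: cP; rewrite /is_profile (@sum_cyclic_fixed _ _ i) ?ci //.
by rewrite {1}ip ord_predK.
Qed.

Lemma is_profile_hop (r : nat) (c : r.-tuple nat) (i : 'I_r) :
  (0 < tnth c i)%N -> is_profile c -> is_profile (hop c i).
Proof. by move=> ci; rewrite /is_profile sum_hop. Qed.

Lemma push_pop (r M : nat) (i : 'I_r) (L : r.-tuple (seq nat)) :
  (forall k, is_partition (tnth L k)) ->
  (forall k x, x \in tnth L k -> x <= M)%N -> M \in tnth L i ->
  nth 0%N (tnth L i) 0 = M /\ exists L', L = push M i L'.
Proof.
move=> Lp LM Mi.
have [s Ls] : exists s, tnth L i = M :: s.
  move: (Lp i) (LM i) Mi; case: (tnth L i) => // x s.
  rewrite is_partition_cons => /and3P[/allP xs _ _] sM Mi.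
  exists s; congr cons; apply/eqP; rewrite eqn_leq sM ?mem_head //=.
  by move: Mi; rewrite inE => /predU1P[->|/xs].
rewrite Ls; split=> //; exists [tuple if k == i then s else tnth L k | k < r].
apply: eq_from_tnth => k; rewrite !tnth_mktuple.
by case: eqP => // ->; rewrite Ls.
Qed.

(** Induction on [M]: a part [M.+1] heads some component [i] with [0 < tnth c i], and by
    distinctness the parts that remain are at most [M]. *)
Lemma mem_enum_distinct (r M : nat) (c : r.-tuple nat) (L : r.-tuple (seq nat)) :
  is_profile c ->
  L \in enum_distinct M c <->
  [/\ is_cylindric c L, distinct_parts L &
      forall k x, x \in tnth L k -> (x <= M)%N].
Proof.
elim: M c L => [|M IH] c L cP /=.
  rewrite mem_seq1; split=> [/eqP ->|[[Lp _] _ LM]].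
    split.
    - by split=> [k|k j]; rewrite !tnth_mktuple ?nth_nil.
    - rewrite /distinct_parts.
      suff -> : flatten [tuple [::] | _ < r] = [::] :> seq nat by [].
      by rewrite /= /enum_tuple; elim: (enum _).
    - by move=> k x; rewrite tnth_mktuple.
  apply/eqP/eq_from_tnth => k; rewrite tnth_mktuple.
  move: (LM k) (Lp k); case: (tnth L k) => // x s /(_ x (mem_head _ _)).
  by rewrite leqn0 => /eqP ->; rewrite /is_partition inE eqxx andbF.
rewrite mem_cat; split.
  case/orP=> [/(IH _ _ cP)[Lc Ld LM]|].
    by split=> // k x /LM /leqW.
  case/flatten_mapP=> i; rewrite mem_filter => /andP[ci _] /mapP[L' L'e ->].
  have {L'e} [Lc Ld LM] := (IH _ _ (is_profile_hop ci cP)).1 L'e.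
  split.
  - exact/cylindric_push.
  - rewrite distinct_parts_push Ld andbT.
    by apply/negP => /mem_flatten_tuple[k /LM]; rewrite ltnn.
  - move=> k x; rewrite mem_push => /orP[/andP[_ /eqP ->]|/LM] //.
    exact: leqW.
case=> Lc Ld LM; apply/orP.
have [|/negP Mn] := boolP (M.+1 \in flatten L); last first.
  left; apply/IH => //; split=> // k x xk.
  have := LM k x xk; rewrite leq_eqVlt => /predU1P[xM|//].
  by case: Mn; apply/mem_flatten_tuple; exists k; rewrite -xM.
case/mem_flatten_tuple=> i Mi; right.
have [LMi [L' LL']] := push_pop Lc.1 LM Mi.
have ci := largest_part_pos cP Lc Ld LM LMi.
apply/flatten_mapP; exists i; first by rewrite mem_filter ci mem_enum.
rewrite LL'; apply: map_f.
move: Ld; rewrite LL' distinct_parts_push => /andP[Mn Ld].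
have LM' k x : x \in tnth L' k -> (x <= M)%N.
  move=> xk; have := LM k x; rewrite LL' mem_push xk orbT => /(_ isT).
  rewrite leq_eqVlt => /predU1P[xM|//].
  by case/negP: Mn; apply/mem_flatten_tuple; exists k; rewrite -xM.
apply/IH; first exact: is_profile_hop.
by split=> //; apply/(cylindric_push ci LM'); rewrite -LL'.
Qed.

Lemma push_inj (r M : nat) (i : 'I_r) : injective (push M i).
Proof.
move=> L L' e; apply: eq_from_tnth => k.
have := congr1 (fun t => tnth t k) e; rewrite !tnth_mktuple.
by case: ifP => // _ [].
Qed.

(** The blocks are disjoint because they differ in where [M.+1] sits: nowhere in the first, only in
    component [i] in block [i]. *)
Lemma uniq_enum_distinct (r M : nat) (c : r.-tuple nat) :
  is_profile c -> uniq (enum_distinct M c).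
Proof.
elim: M c => // M IH c cP /=; rewrite cat_uniq IH //=; apply/andP; split.
  apply/hasPn => L /allpairsPdep[i [L' [+ _ ->]]].
  rewrite mem_filter => /andP[ci _].
  apply/negP => /(mem_enum_distinct _ _ cP)[_ _].
  by move=> /(_ i M.+1); rewrite mem_push !eqxx ltnn => /(_ isT).
apply: allpairs_uniq_dep => [|i|[i L] [k L']].
- by rewrite filter_uniq ?enum_uniq.
- rewrite mem_filter => /andP[ci _]; exact/IH/is_profile_hop.
- case/allpairsPdep=> i1 [L1] [+ L1e [-> ->]].
  rewrite mem_filter => /andP[ci _].
  case/allpairsPdep=> i2 [L2] [+ L2e [-> ->]].
  rewrite mem_filter => /andP[ck _].
  move=> /= e; have ik : i1 = i2.
    have := mem_push M.+1 i1 i1 L1 M.+1; rewrite e mem_push !eqxx /=.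
    rewrite andbT => /orP[/eqP //|].
    have [_ _ LM] := (mem_enum_distinct _ _ (is_profile_hop ck cP)).1 L2e.
    by move=> /LM; rewrite ltnn.
  by rewrite ik in e *; rewrite (push_inj e).
Qed.

Lemma le_part_cyl_size (r : nat) (L : r.-tuple (seq nat)) k x :
  x \in tnth L k -> (x <= cyl_size L)%N.
Proof.
move=> xk; rewrite cyl_sizeE.
have : x \in flatten L by apply/mem_flatten_tuple; exists k.
elim: (flatten L) => //= y s IH; rewrite inE => /predU1P[->|/IH].
  exact: leq_addr.
by move=> h; apply: leq_trans h (leq_addl _ _).
Qed.

(** No part exceeds the size [n], so every bound [M] from [n] on gives the full count. *)
Lemma cyl_distinct_countE (r n M : nat) (c : r.-tuple nat) :
  is_profile c -> (n <= M)%N ->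
  cyl_distinct_count c n =
  count (fun L => cyl_size L == n) (enum_distinct M c).
Proof.
move=> cP nM; rewrite /cyl_distinct_count -size_filter.
rewrite -(undup_id (filter_uniq _ (uniq_enum_distinct M cP))) -card_fseq.
congr (#|` _|); apply/fsetP => L.
rewrite in_fset_set; last exact: cyl_distinct_finite.
rewrite !inE mem_filter.
apply/idP/idP => [/set_mem[Lc Ld Ln]|
  /andP[/eqP Ln /(mem_enum_distinct _ _ cP)[Lc Ld _]]].
  rewrite Ln eqxx; apply/mem_enum_distinct => //; split=> // k x xk.
  by apply: leq_trans nM; rewrite -Ln; exact: le_part_cyl_size xk.
by apply/mem_set; split.
Qed.

(** * The matrix of moves between profiles *)

(** Entries of a tuple of sum [l] are at most [l], so tuples over ['I_l.+1] suffice. *)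
Definition profiles (r l : nat) : seq (r.-tuple nat) :=
  [seq map_tuple (@nat_of_ord l.+1) t |
    t : r.-tuple 'I_l.+1 <- enum {: r.-tuple 'I_l.+1} &
    (\sum_(i < r) tnth t i == l)%N].

Lemma mem_profiles (r l : nat) (c : r.-tuple nat) :
  (c \in profiles r l) = (\sum_(i < r) tnth c i == l)%N.
Proof.
apply/mapP/idP => [[t + ->]|/eqP cl].
  rewrite mem_filter => /andP[/eqP tl _]; rewrite -[X in _ == X]tl.
  by apply/eqP/eq_bigr => i _; rewrite tnth_map.
have cK (i : 'I_r) : val (@inord l (tnth c i)) = tnth c i.
  by apply: inordK; rewrite ltnS -cl (bigD1 i) //= leq_addr.
exists [tuple inord (tnth c i) | i < r].
  rewrite mem_filter mem_enum andbT -[X in _ == X]cl.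
  by apply/eqP/eq_bigr => i _; rewrite tnth_mktuple cK.
by apply: eq_from_tnth => i; rewrite tnth_map tnth_mktuple cK.
Qed.

(** The entry of the matrix A in row [c] and column [d]. *)
Definition hops (r : nat) (c d : r.-tuple nat) : nat :=
  (\sum_(i < r) ((0 < tnth c i) && (hop c i == d)))%N.

(** The reverse of the move at [i]; meaningful only if [0 < tnth c (ordS i)]. *)
Definition unhop (r : nat) (c : r.-tuple nat) (i : 'I_r) : r.-tuple nat :=
  [tuple (tnth c k - (k == ordS i) + (k == i))%N | k < r].

Lemma unhopE (r : nat) (c : r.-tuple nat) (i k : 'I_r) :
  (0 < tnth c (ordS i))%N ->
  (tnth (unhop c i) k + (k == ordS i) = tnth c k + (k == i))%N.
Proof.
move=> ci; rewrite tnth_mktuple addnAC subnK //.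
by case: eqVneq => // ->.
Qed.

Lemma hop_unhop (r : nat) (c d : r.-tuple nat) (i : 'I_r) :
  (0 < tnth c i)%N && (hop c i == d) =
  (0 < tnth d (ordS i))%N && (unhop d i == c).
Proof.
apply/andP/andP => -[pos /eqP <-].
  have pos' : (0 < tnth (hop c i) (ordS i))%N.
    by rewrite tnth_mktuple eqxx addn1.
  split=> //; apply/eqP/eq_from_tnth => k.
  by apply: (@addIn (k == ordS i)); rewrite unhopE // hopE.
have pos' : (0 < tnth (unhop d i) i)%N by rewrite tnth_mktuple eqxx addn1.
split=> //; apply/eqP/eq_from_tnth => k.
by apply: (@addIn (k == i)); rewrite hopE // unhopE.
Qed.

(* [hop x i = hop y j] and [unhop x j = unhop y i], with all subtractions moved
   across. *)
Definition balanced (r : nat) (x y : r.-tuple nat) (i j : 'I_r) : bool :=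
  [forall k : 'I_r, tnth x k + (k == ordS i) + (k == j) ==
                    tnth y k + (k == ordS j) + (k == i)]%N.

(** As [i != j] excludes r = 1, no index is its own successor; the equations at [k = i] and [k = j]
    then force the two positivity conditions. *)
Lemma hop_eqE (r : nat) (x y : r.-tuple nat) (i j : 'I_r) : i != j ->
  [&& 0 < tnth x i, 0 < tnth y j & hop x i == hop y j]%N = balanced x y i j.
Proof.
move=> ij; apply/and3P/forallP => [[xi yj /eqP xy] k|E].
  have := hopE k xi; have := hopE k yj; rewrite xy => <- e.
  by rewrite -e addnAC.
have Sk (k : 'I_r) : (k == ordS k) = false.
  apply/eqP => /esym /ordS_fixed r1; move: ij.
  by move: (i) (j); rewrite r1 => i' j'; rewrite (ord1 i') (ord1 j') eqxx.
have xi : (0 < tnth x i)%N.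
  by have /eqP := E i; rewrite eqxx Sk (negPf ij); lia.
have yj : (0 < tnth y j)%N.
  by have /eqP := E j; rewrite eqxx Sk [j == i]eq_sym (negPf ij); lia.
split=> //; apply/eqP/eq_from_tnth => k.
have /eqP := E k; rewrite -(hopE k xi) -(hopE k yj) addnAC.
by move=> /addIn /addIn.
Qed.

(** Here positivity comes from the equations at [ordS j] and [ordS i]. *)
Lemma unhop_eqE (r : nat) (x y : r.-tuple nat) (i j : 'I_r) : i != j ->
  [&& 0 < tnth x (ordS j), 0 < tnth y (ordS i) & unhop x j == unhop y i]%N =
  balanced x y i j.
Proof.
move=> ij; apply/and3P/forallP => [[xj yi /eqP xy] k|E].
  have := unhopE k xj; have := unhopE k yi; rewrite xy => e1 e2.
  by rewrite addnAC -e2 [X in _ == X]addnAC -e1 addnAC.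
have Sk (k : 'I_r) : (ordS k == k) = false.
  apply/eqP => /ordS_fixed r1; move: ij.
  by move: (i) (j); rewrite r1 => i' j'; rewrite (ord1 i') (ord1 j') eqxx.
have Sij : (ordS j == ordS i) = false.
  by rewrite (inj_eq (@ordS_inj _)) eq_sym (negPf ij).
have xj : (0 < tnth x (ordS j))%N.
  by have /eqP := E (ordS j); rewrite eqxx Sk Sij; lia.
have yi : (0 < tnth y (ordS i))%N.
  by have /eqP := E (ordS i); rewrite eqxx Sk [ordS i == ordS j]eq_sym Sij; lia.
split=> //; apply/eqP/eq_from_tnth => k.
have /eqP := E k; rewrite addnAC -(unhopE k xj) [RHS]addnAC -(unhopE k yi).
by rewrite addnAC => /addIn /addIn.
Qed.

Lemma sum_seq_sub_eq (T : choiceType) (s : seq T) (F : T -> nat) (w : T) :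
  w \in s -> (\sum_(z : seq_sub s) (w == val z) * F (val z) = F w)%N.
Proof.
move=> ws; rewrite (bigD1 (SeqSub ws)) //= eqxx mul1n big1 ?addn0 // => z zw.
have /negPf -> : w != val z by apply: contraNneq zw => wz; exact/eqP/val_inj.
by rewrite mul0n.
Qed.

Lemma mem_profiles_hop (r l : nat) (c : r.-tuple nat) (i : 'I_r) :
  (0 < tnth c i)%N -> c \in profiles r l -> hop c i \in profiles r l.
Proof. by move=> ci; rewrite !mem_profiles sum_hop. Qed.

Lemma mem_profiles_unhop (r l : nat) (c : r.-tuple nat) (i : 'I_r) :
  (0 < tnth c (ordS i))%N -> c \in profiles r l -> unhop c i \in profiles r l.
Proof.
move=> ci; have := hop_unhop (unhop c i) c i.
by rewrite ci eqxx !mem_profiles => /andP[pos /eqP e]; rewrite -(sum_hop pos) e.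
Qed.

(** Closure of [s] under moves keeps the common target [z] in range, so it can be summed out. The
    left side is an entry of A times its transpose. *)
Lemma sum_hops_mul (r : nat) (s : seq (r.-tuple nat)) (x y : seq_sub s) :
  (forall c i, (0 < tnth c i)%N -> c \in s -> hop c i \in s) ->
  (\sum_(z : seq_sub s) hops (val x) (val z) * hops (val y) (val z) =
   \sum_(i < r) \sum_(j < r) [&& 0 < tnth (val x) i, 0 < tnth (val y) j &
     hop (val x) i == hop (val y) j])%N.
Proof.
move=> s_hop; rewrite /hops; under eq_bigr do rewrite big_distrlr /=.
rewrite exchange_big /=; apply: eq_bigr => i _.
rewrite exchange_big /=; apply: eq_bigr => j _.
case: (ltnP 0 (tnth (val x) i)) => xi /=; last by rewrite big1.
rewrite (sum_seq_sub_eq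
    (fun w => (0 < tnth (val y) j)%N && (hop (val y) j == w) : nat)
    (s_hop _ _ xi (valP x))).
by rewrite [hop (val y) j == _]eq_sym.
Qed.

(** The same for the transpose times A: a common source is a common target of backward moves. *)
Lemma sum_mul_hops (r : nat) (s : seq (r.-tuple nat)) (x y : seq_sub s) :
  (forall c i, (0 < tnth c (ordS i))%N -> c \in s -> unhop c i \in s) ->
  (\sum_(z : seq_sub s) hops (val z) (val x) * hops (val z) (val y) =
   \sum_(i < r) \sum_(j < r) [&& 0 < tnth (val x) (ordS i),
     0 < tnth (val y) (ordS j) & unhop (val x) i == unhop (val y) j])%N.
Proof.
move=> s_unhop; transitivity (\sum_(z : seq_sub s)
    (\sum_(i < r) ((0 < tnth (val x) (ordS i)) && (unhop (val x) i == val z))) *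
    (\sum_(j < r) ((0 < tnth (val y) (ordS j)) && (unhop (val y) j == val z))))%N.
  by apply: eq_bigr => z _; congr (_ * _)%N; apply: eq_bigr => i _;
    rewrite hop_unhop.
under eq_bigr do rewrite big_distrlr /=.
rewrite exchange_big /=; apply: eq_bigr => i _.
rewrite exchange_big /=; apply: eq_bigr => j _.
case: (ltnP 0 (tnth (val x) (ordS i))) => xi /=; last by rewrite big1.
rewrite (sum_seq_sub_eq
    (fun w => (0 < tnth (val y) (ordS j))%N && (unhop (val y) j == w) : nat)
    (s_unhop _ _ xi (valP x))).
by rewrite [unhop (val y) j == _]eq_sym.
Qed.

(** Off the diagonal both conditions are [balanced], after swapping the two indices on one side. On
    the diagonal both sides count the positive entries of [x] if [x = y], and 0 otherwise. *)
Lemma sum_hop_pairs (r : nat) (x y : r.-tuple nat) :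
  (\sum_(i < r) \sum_(j < r)
      [&& 0 < tnth x i, 0 < tnth y j & hop x i == hop y j] =
   \sum_(i < r) \sum_(j < r)
      [&& 0 < tnth x (ordS i), 0 < tnth y (ordS j) & unhop x i == unhop y j])%N.
Proof.
rewrite [RHS]exchange_big /=.
under eq_bigr => i _ do rewrite (bigD1 i) //=.
under [RHS]eq_bigr => i _ do rewrite (bigD1 i) //=.
rewrite !big_split /=; congr (_ + _)%N; last first.
  apply: eq_bigr => i _; apply: eq_bigr => j ji.
  by rewrite hop_eqE ?unhop_eqE // eq_sym.
have hop_inj i : [&& 0 < tnth x i, 0 < tnth y i & hop x i == hop y i]%N =
    (x == y) && (0 < tnth x i)%N.
  apply/and3P/andP => [[xi yi /eqP xy]|[/eqP <- xi]]; last by split.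
  split=> //; apply/eqP/eq_from_tnth => k.
  by apply: (@addIn (k == ordS i)); rewrite -(hopE k xi) -(hopE k yi) xy.
have unhop_inj i :
    [&& 0 < tnth x (ordS i), 0 < tnth y (ordS i) & unhop x i == unhop y i]%N =
    (x == y) && (0 < tnth x (ordS i))%N.
  apply/and3P/andP => [[xi yi /eqP xy]|[/eqP <- xi]]; last by split.
  split=> //; apply/eqP/eq_from_tnth => k.
  by apply: (@addIn (k == i)); rewrite -(unhopE k xi) -(unhopE k yi) xy.
(* The two diagonals differ by a cyclic shift of the index. *)
rewrite (reindex_inj (@ordS_inj r)).
by apply: eq_bigr => i _; rewrite hop_inj unhop_inj.
Qed.

Lemma hops_normal (r l : nat) (x y : seq_sub (profiles r l)) :
  (\sum_(z : seq_sub (profiles r l)) hops (val x) (val z) * hops (val y) (val z) =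
   \sum_(z : seq_sub (profiles r l)) hops (val z) (val x) * hops (val z) (val y))%N.
Proof.
rewrite (sum_hops_mul x y (@mem_profiles_hop r l)) sum_hop_pairs.
by rewrite (sum_mul_hops x y (@mem_profiles_unhop r l)).
Qed.

(** * Generating functions with bounded parts *)

Definition genfun (K : comNzRingType) (r M : nat) (c : r.-tuple nat) (q : K) : K :=
  \sum_(L <- enum_distinct M c) q ^+ cyl_size L.

Lemma genfun0 (K : comNzRingType) (r : nat) (c : r.-tuple nat) (q : K) :
  genfun 0 c q = 1.
Proof.
rewrite /genfun /= big_seq1 /cyl_size big1 // => i _.
by rewrite tnth_mktuple.
Qed.

Lemma genfunS (K : comNzRingType) (r M : nat) (c : r.-tuple nat) (q : K) :
  genfun M.+1 c q =
  genfun M c q + q ^+ M.+1 * \sum_(i < r | (0 < tnth c i)%N) genfun M (hop c i) q.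
Proof.
rewrite /genfun /= big_cat big_flatten big_map big_filter big_enum_cond /=.
congr (_ + _); rewrite mulr_sumr; apply: eq_bigr => i _.
rewrite big_map mulr_sumr; apply: eq_bigr => L _.
by rewrite cyl_size_push exprD.
Qed.

Lemma genfun_recursion (K : comNzRingType) (r l M : nat)
    (x : seq_sub (profiles r l)) (q : K) :
  genfun M.+1 (val x) q = genfun M (val x) q +
    q ^+ M.+1 *
    \sum_(y : seq_sub (profiles r l))
      (hops (val x) (val y))%:R * genfun M (val y) q.
Proof.
rewrite genfunS; congr (_ + _ * _).
under [RHS]eq_bigr do rewrite natr_sum mulr_suml.
rewrite exchange_big /= big_mkcond; apply: eq_bigr => i _.
case: ltnP => xi; last by rewrite big1 // => y _; rewrite mul0r.
rewrite (bigD1 (SeqSub (mem_profiles_hop xi (valP x)))) //= eqxx mul1r.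
rewrite big1 ?addr0 // => y yx.
have /negPf -> : hop (val x) i != val y.
  by apply: contraNneq yx => xy; exact/eqP/val_inj.
by rewrite mul0r.
Qed.

(** * Solving the recursion of a normal matrix *)

(** In a unitary eigenbasis the recursion decouples: step [M] multiplies coordinate [i] by
    [1 + beta i * t M]. Since [alpha] and [beta] are chosen before [t], they will not depend on
    q. *)
Lemma normal_recursion (C : numClosedFieldType) (S : finType)
    (a : S -> S -> nat) (f0 : S -> C) :
  (forall x y, \sum_z a x z * a y z = \sum_z a z x * a z y)%N ->
  exists (n : nat) (alpha : S -> 'I_n -> C) (beta : 'I_n -> C),
    forall (t : nat -> C) (f : nat -> S -> C),
    f 0%N =1 f0 ->
    (forall M x, f M.+1 x = f M x + t M * \sum_y (a x y)%:R * f M y) ->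
    forall M x, f M x = \sum_i alpha x i * \prod_(j < M) (1 + beta i * t j).
Proof.
move=> aN; pose A : 'M[C]_#|S| := \matrix_(i, j) (a (enum_val i) (enum_val j))%:R.
have val_bij : {on [pred _ : S | true], bijective (@enum_val S S)}.
  exact/onW_bij/enum_val_bij.
(* The entries are natural numbers, so the adjoint is the transpose and the hypothesis on [a] is
   normality. *)
have AN : A \is normalmx.
  apply/normalmxP/matrixP => i j; rewrite !mxE.
  have /(congr1 (fun n : nat => n%:R : C)) := aN (enum_val i) (enum_val j).
  rewrite !natr_sum !(reindex _ val_bij) /= => aNij.
  transitivity (\sum_(k < #|S|)
      (a (enum_val i) (enum_val k) * a (enum_val j) (enum_val k))%:R : C).
    by apply: eq_bigr => k _; rewrite !mxE conjC_nat natrM.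
  by rewrite aNij; apply: eq_bigr => k _; rewrite !mxE conjC_nat natrM.
have AE := orthomx_spectralP AN.
set P := spectralmx A in AE; set d := spectral_diag A in AE.
have PU : P \in unitmx := spectral_unit A.
pose v (g : S -> C) : 'cV[C]_#|S| := \col_i g (enum_val i).
(* [P *m v f0] holds the eigencoordinates of the initial vector, row [enum_rank x] of [invmx P]
   leads back to the value at [x], and [d] lists the eigenvalues. *)
exists #|S|, (fun x i => invmx P (enum_rank x) i * (P *m v f0) i 0), (d 0).
move=> t f f_0 fS.
have Pv M i : (P *m v (f M)) i 0 =
    (P *m v f0) i 0 * \prod_(j < M) (1 + d 0 i * t j).
  elim: M => [|M IH].
    rewrite big_ord0 mulr1; congr ((_ *m _) _ _).
    by apply/colP => k; rewrite !mxE f_0.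
  have -> : v (f M.+1) = v (f M) + t M *: (A *m v (f M)).
    apply/colP => k; rewrite !mxE fS (reindex _ val_bij) /=.
    by congr (_ + _ * _); apply: eq_bigr => l _; rewrite !mxE.
  rewrite mulmxDr -scalemxAr AE !mulmxA mulmxV // mul1mx -mulmxA.
  rewrite mul_diag_mx mxE [X in _ + X]mxE [X in _ + _ * X]mxE IH big_ord_recr /=.
  by ring.
move=> M x; transitivity (v (f M) (enum_rank x) 0).
  by rewrite mxE enum_rankK.
rewrite -(mulKmx PU (v (f M))) mxE.
by apply: eq_bigr => i _; rewrite Pv mulrA.
Qed.

(** * Convergence *)

(** A positive complex number has zero imaginary part, so real [e] suffice. *)
Lemma cvg_complex_le (R : realType) (u : nat -> R[i]) (l : R[i]) :
  (forall e : R, 0 < e -> \forall n \near \oo, `|l - u n| <= e%:C) ->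
  u @ \oo --> l.
Proof.
move=> H; apply/cvgrPdist_le => e e_gt0.
have : (0 : R[i]) < (e : R[i]) := e_gt0; rewrite ltcE => /andP[/eqP ie e0].
have -> : e = (complex.Re e)%:C by apply/eqP; rewrite eq_complex /= ie !eqxx.
exact: H.
Qed.

Lemma norm_normc (R : rcfType) (z : R[i]) : `|z| = (normc z)%:C.
Proof. by []. Qed.

Lemma normc_lt1 (R : rcfType) (z : R[i]) : `|z| < 1 -> 0 <= normc z < 1.
Proof. by move=> z1; rewrite -ler0c -ltcR -!norm_normc normr_ge0. Qed.

Lemma normc_le_Re_Im (R : rcfType) (z : R[i]) :
  `|z| <= (`|complex.Re z| + `|complex.Im z|)%:C.
Proof.
have {1}-> : z = (complex.Re z)%:C + 'i%C * (complex.Im z)%:C by exact: complexE.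
apply: le_trans (ler_normD _ _) _.
rewrite rmorphD /= normrM; apply: lerD.
  by rewrite normc_def /= expr0n addr0 sqrtr_sqr.
by rewrite !normc_def /= !expr0n /= add0r addr0 expr1n sqrtr1 mul1r sqrtr_sqr.
Qed.

Lemma cvg_abs_telescope (R : realType) (u v : nat -> R) :
  (forall n, `|u n.+1 - u n| <= v n) -> cvgn (series v) -> cvgn u.
Proof.
move=> uv cv.
have cs : cvgn (series (telescope u)).
  apply: normed_cvg; apply: series_le_cvg cv => n /=.
  - exact: normr_ge0.
  - exact: le_trans (uv n).
  - exact: uv.
rewrite telescopeK in cs.
have -> : u = (fun n => (u n - u 0%N) + u 0%N).
  by apply/funext => n; rewrite subrK.
by apply: is_cvgD => //; exact: is_cvg_cst.
Qed.
(** Combines [1 + y <= expR y] with the bound [1 / (1 - x)] on the geometric sum. *)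
Lemma prod_1Dgeo_bounded (R : realType) (b x : R) (n : nat) :
  0 <= b -> 0 <= x < 1 ->
  \prod_(j < n) (1 + b * x ^+ j.+1) <= expR (b / (1 - x)).
Proof.
move=> b0 /andP[x0 x1].
apply: (@le_trans _ _ (expR (b * \sum_(j < n) x ^+ j.+1))).
  rewrite mulr_sumr expR_sum; apply: ler_prod => j _.
  by rewrite expR_ge1Dx andbT addr_ge0 ?mulr_ge0 ?exprn_ge0.
rewrite ler_expR; apply: ler_wpM2l => //.
rewrite -[leRHS]mul1r ler_pdivlMr ?subr_gt0 //.
have -> : \sum_(j < n) x ^+ j.+1 = x * \sum_(j < n) x ^+ j.
  by rewrite mulr_sumr; apply: eq_bigr => j _; rewrite exprS.
have := subrX1 x n; have := exprn_ge0 n x0; set s := \sum_(_ < _) _.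
nra.
Qed.

Lemma cvg_complex_telescope (R : realType) (u : nat -> R[i]) (v : nat -> R) :
  (forall n, `|u n.+1 - u n| <= (v n)%:C) -> cvgn (series v) -> cvgn u.
Proof.
move=> uv cv.
have cRe : cvgn (fun n => complex.Re (u n)).
  apply: cvg_abs_telescope cv => n; rewrite -lecR -raddfB /=.
  exact: le_trans (normc_ge_Re _) (uv n).
have cIm : cvgn (fun n => complex.Im (u n)).
  (* Up to sign, the imaginary part is the real part after multiplication by i, which preserves the
     modulus. *)
  apply: cvg_abs_telescope cv => n; rewrite -lecR -raddfB /= -normrN -ReiNIm.
  apply: le_trans (normc_ge_Re _) _; rewrite normrM.
  by rewrite [X in _ * X]normc_def /= expr0n add0r expr1n sqrtr1 mulr1.
apply/cvg_ex; exists (limn (fun n => complex.Re (u n)) +i*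
                      limn (fun n => complex.Im (u n))).
apply: cvg_complex_le => e e0; near=> n.
apply: le_trans (normc_le_Re_Im _) _; rewrite lecR [e]splitr.
rewrite !raddfB /=; apply: lerD; near: n.
- by move/cvgrPdist_le: cRe; apply; exact: divr_gt0.
- by move/cvgrPdist_le: cIm; apply; exact: divr_gt0.
Unshelve. all: by end_near. Qed.

(** Since [qPochhammer] is a [limn], what must be shown is that the products converge; their
    increments decay geometrically. *)
Lemma cvg_qPochhammer (R : realType) (b q : R[i]) : `|q| < 1 ->
  (fun n => \prod_(j < n) (1 + b * q ^+ j.+1)) @ \oo -->
  qPochhammer (- (b * q)) q.
Proof.
move=> q1; rewrite /qPochhammer.
have -> : (fun n => \prod_(j < n) (1 - - (b * q) * q ^+ j)) =
          (fun n => \prod_(j < n) (1 + b * q ^+ j.+1)).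
  apply/funext => n; apply: eq_bigr => j _.
  by rewrite mulNr opprK exprS mulrA.
set x := normc q; set d := normc b.
have x1 : 0 <= x < 1 by exact: normc_lt1.
have d0 : 0 <= d by rewrite -ler0c -norm_normc.
(* Bounds the modulus of every partial product; the increment at [n] is that product times
   [b * q ^+ n.+1]. *)
pose e := expR (d / (1 - x)).
apply: (@cvg_complex_telescope _ _ (geometric (e * (d * x)) x)).
  move=> n; rewrite big_ord_recr /= mulrDr mulr1 addrAC subrr add0r.
  rewrite -!mulrA -exprS rmorphM normrM /=; apply: ler_pM => //.
    apply: (@le_trans _ _ (\prod_(j < n) (1 + d * x ^+ j.+1))%:C).
      rewrite normr_prod rmorph_prod /=; apply: ler_prod => j _.
      rewrite normr_ge0 /= rmorphD rmorph1 rmorphM rmorphXn /=.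
      by apply: le_trans (ler_normD _ _) _; rewrite normr1 normrM normrX.
    by rewrite lecR; exact: prod_1Dgeo_bounded.
  by rewrite normrM normrX rmorphM rmorphXn.
by apply: is_cvg_geometric_series; case/andP: x1 => x0 x1; rewrite ger0_norm.
Qed.

(** * From bounded parts to the power series *)

(** Every [n < N] satisfies [n <= M], so the enumeration is complete in these sizes; exchanging the
    sums sorts it by size. *)
Lemma sum_cyl_distinct_count (K : comNzRingType) (r M N : nat)
    (c : r.-tuple nat) (q : K) :
  is_profile c -> (N <= M.+1)%N ->
  \sum_(0 <= n < N) (cyl_distinct_count c n)%:R * q ^+ n =
  \sum_(L <- enum_distinct M c | (cyl_size L < N)%N) q ^+ cyl_size L.
Proof.
move=> cP NM; transitivity (\sum_(0 <= n < N)
    \sum_(L <- enum_distinct M c | cyl_size L == n) q ^+ n).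
  rewrite !big_nat; apply: eq_bigr => n nN.
  rewrite (@cyl_distinct_countE _ _ M) //; last by lia.
  by rewrite -sum1_count natr_sum mulr_suml; apply: eq_bigr => L _; rewrite mul1r.
rewrite (exchange_big_dep xpredT) //= [RHS]big_mkcond /=.
apply: eq_bigr => L _; case: ltnP => LN.
  rewrite big_mkord (bigD1 (Ordinal LN)) //= big1 ?addr0 // => n.
  by move=> /andP[/eqP Ln]; rewrite -val_eqE /= Ln eqxx.
rewrite big_nat_cond big1 // => n /andP[/andP[_ nN] /eqP Ln].
by move: nN; rewrite -Ln ltnNge LN.
Qed.

(** At most [r] moves leave a profile, so passing to [M.+1] costs a factor of at most
    [1 + r%:R * x ^+ M.+1], for all [c] at once. *)
Lemma genfun_bounded (R : realType) (r M : nat) (c : r.-tuple nat) (x : R) :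
  0 <= x < 1 -> genfun M c x <= expR (r%:R / (1 - x)).
Proof.
move=> x01; have [x0 _] := andP x01.
apply: (@le_trans _ _ (\prod_(j < M) (1 + r%:R * x ^+ j.+1))); last first.
  exact: prod_1Dgeo_bounded.
elim: M c => [|M IH] c; first by rewrite genfun0 big_ord0.
rewrite genfunS big_ord_recr /=; set P := \prod_(_ < M) _ in IH *.
have P0 : 0 <= P.
  by apply: prodr_ge0 => j _; rewrite addr_ge0 // mulr_ge0 ?exprn_ge0.
rewrite mulrDr mulr1; apply: lerD => //.
rewrite mulrA mulrC; apply: ler_wpM2r; first exact: exprn_ge0.
apply: (@le_trans _ _ (\sum_(i < r) P)); last first.
  by rewrite sumr_const card_ord mulr_natr.
by rewrite big_mkcond; apply: ler_sum => i _; case: ifP.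
Qed.

Lemma ler_sum_enum_distinct (R : realType) (r M M' : nat) (c : r.-tuple nat)
    (x : R) (P : pred (r.-tuple (seq nat))) : 0 <= x -> (M <= M')%N ->
  \sum_(L <- enum_distinct M c | P L) x ^+ cyl_size L <=
  \sum_(L <- enum_distinct M' c | P L) x ^+ cyl_size L.
Proof.
move=> x0; elim: M' => [|M' IH]; first by rewrite leqn0 => /eqP ->.
rewrite leq_eqVlt => /predU1P[-> //|]; rewrite ltnS => /IH h.
apply: le_trans h _; rewrite /= big_cat /= lerDl.
by apply: sumr_ge0 => L _; exact: exprn_ge0.
Qed.

(* [genfun N c x] lies between the partial sums of the series at N and at any K
   above all the sizes occurring in [enum_distinct N c]. *)
Lemma genfun_tail_cvg0 (R : realType) (r : nat) (c : r.-tuple nat) (x : R) :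
  is_profile c -> 0 <= x < 1 ->
  (fun N => \sum_(L <- enum_distinct N c | ~~ (cyl_size L < N)%N)
              x ^+ cyl_size L) @ \oo --> (0 : R).
Proof.
move=> cP x01; have [x0 _] := andP x01.
pose T N := \sum_(0 <= n < N) (cyl_distinct_count c n)%:R * x ^+ n.
have T_ge0 n : 0 <= (cyl_distinct_count c n)%:R * x ^+ n.
  by rewrite mulr_ge0 ?exprn_ge0.
have TE N : genfun N c x = T N +
    \sum_(L <- enum_distinct N c | ~~ (cyl_size L < N)%N) x ^+ cyl_size L.
  rewrite /T (@sum_cyl_distinct_count _ _ N) //.
  by rewrite /genfun (bigID (fun L => (cyl_size L < N)%N)).
have T_le N : T N <= genfun N c x.
  by rewrite TE lerDl; apply: sumr_ge0 => L _; exact: exprn_ge0.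
have Tnd : {homo T : n m / (n <= m)%N >-> n <= m}.
  by apply/nondecreasing_seqP => n; rewrite /T big_nat_recr //= lerDl.
have Tcvg : cvgn T.
  apply: nondecreasing_is_cvgn => //.
  exists (expR (r%:R / (1 - x))) => _ [n _ <-].
  exact: le_trans (T_le n) (genfun_bounded _ _ x01).
have genfun_le N : genfun N c x <= limn T.
  pose K := (N + \sum_(L <- enum_distinct N c) cyl_size L)%N.
  apply: le_trans (nondecreasing_cvgn_le Tnd Tcvg K.+1).
  rewrite /T (@sum_cyl_distinct_count _ _ K) //.
  apply: le_trans (ler_sum_enum_distinct _ _ x0 (leq_addr _ N)).
  rewrite le_eqVlt; apply/orP; left; apply/eqP.
  rewrite /genfun big_seq [RHS]big_seq_cond; apply: eq_bigl => L.
  case: (boolP (L \in _)) => //= Le; rewrite ltnS; apply/esym.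
  by rewrite /K (big_rem L) //= addnCA leq_addr.
have -> : (fun N => \sum_(L <- enum_distinct N c | ~~ (cyl_size L < N)%N)
              x ^+ cyl_size L) = (fun N => genfun N c x - T N).
  by apply/funext => N; rewrite TE addrAC subrr add0r.
rewrite -(subrr (limn T)); apply: cvgB => //.
apply: (squeeze_cvgr _ Tcvg (cvg_cst _)).
by near=> N; rewrite T_le genfun_le.
Unshelve. all: by end_near. Qed.

(** Partial sum [N] is [genfun N c q] without its terms of size at least [N]; their sum is dominated
    by the same tail at [normc q], which tends to 0. *)
Lemma cvg_series_genfun (R : realType) (r : nat) (c : r.-tuple nat)
    (q l : R[i]) :
  is_profile c -> `|q| < 1 -> (fun N => genfun N c q) @ \oo --> l ->
  series (fun n => (cyl_distinct_count c n)%:R * q ^+ n) @ \oo --> l.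
Proof.
move=> cP q1 gl.
have x01 := normc_lt1 q1.
pose d N := \sum_(L <- enum_distinct N c | ~~ (cyl_size L < N)%N) q ^+ cyl_size L.
have d0 : d @ \oo --> (0 : R[i]).
  apply: cvg_complex_le => e e0.
  have /cvgrPdist_le /(_ e e0) := genfun_tail_cvg0 cP x01.
  apply: filterS => N; rewrite !sub0r !normrN => h.
  apply: (@le_trans _ _ (\sum_(L <- enum_distinct N c | ~~ (cyl_size L < N)%N)
              normc q ^+ cyl_size L)%:C).
    rewrite rmorph_sum /=; apply: le_trans (ler_norm_sum _ _ _) _.
    by apply: ler_sum => L _; rewrite normrX rmorphXn.
  by rewrite lecR; apply: le_trans h; exact: ler_norm.
have -> : series (fun n => (cyl_distinct_count c n)%:R * q ^+ n) =
    (fun N => genfun N c q - d N).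
  apply/funext => N; rewrite /series /= (@sum_cyl_distinct_count _ _ N) //.
  by rewrite /genfun [in RHS](bigID (fun L => (cyl_size L < N)%N)) /= addrK.
by rewrite -[l]subr0; apply: (cvgB gl d0).
Qed.

Theorem theorem4 (R : realType) (r : nat) (c : r.-tuple nat) :
  is_profile c ->
  exists (rg : {poly R[i]}) (k : nat) (B : nat -> nat)
         (alpha beta : nat -> nat -> R[i]),
  forall q : R[i], `|q| < 1 ->
    series (fun n : nat => (cyl_distinct_count c n)%:R * q ^+ n) @ \oo -->
      rg.[q]
      + \sum_(i < B 0%N) alpha 0%N i * qPochhammer (- (beta 0%N i * q)) q
      + \sum_(1 <= t < k.+1) \sum_(i < B t)
          alpha t i *
          iter t (@euler_op R) (fun z => qPochhammer (- (beta t i * z * q)) q) 1.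
Proof.
move=> cP; set l := (\sum_(i < r) tnth c i)%N.
have cl : c \in profiles r l by rewrite mem_profiles.
(* The initial vector is constantly 1: with no parts allowed, only the empty tuple is counted. *)
have [n [alpha [beta fE]]] := normal_recursion (C := R[i]) (fun=> 1)
  (@hops_normal r l).
(* Coefficients are indexed by natural numbers in the statement; the default 0 outside ['I_n] never
   enters the sums. *)
pose ext (g : 'I_n -> R[i]) (m : nat) := oapp g 0 (insub m).
(* The polynomial is 0, and [k = 0] makes the sum over [t] empty. *)
exists 0, 0%N, (fun=> n), (fun=> ext (alpha (SeqSub cl))), (fun=> ext beta).
move=> q q1; rewrite horner0 add0r big_geq // addr0.
apply: cvg_series_genfun => //.
have -> : (fun N => genfun N c q) = (fun N =>
    \sum_(i < n) alpha (SeqSub cl) i * \prod_(j < N) (1 + beta i * q ^+ j.+1)).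
  apply/funext => N.
  pose f (M : nat) (x : seq_sub (profiles r l)) := genfun M (val x) q.
  have f0 : f 0%N =1 fun=> 1 by move=> x; exact: genfun0.
  exact: (fE (fun M => q ^+ M.+1) f f0 (fun M x => genfun_recursion M x q) N
            (SeqSub cl)).
apply: cvg_big => [|i _]; first exact: add_continuous.
rewrite /ext valK /=; apply: cvgMl_tmp; exact: cvg_qPochhammer.
Qed.
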